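(* Suppose the worker distance $\mathrm{dist}$ satisfies the triangle inequality. Then algorithm Min-Star-Partition (described in the context) is a $3$-approximation algorithm for the problem SpltBOpt: for every group $\mathcal{G}$ of $n'$ workers and every upper critical mass $K$, the partition $G_1,\dots,G_x$ of $\mathcal{G}$ it returns is feasible for SpltBOpt, and its objective value $\sum_{i<j}\mathrm{SumInterDist}(G_i,G_j)$ is at most $3$ times the optimal value of SpltBOpt.
   Context: Let $\mathcal{G}$ be a finite group of $n'$ workers with a symmetric distance $\mathrm{dist}(u,v)\ge0$, $\mathrm{dist}(u,u)=0$. Let $K$ be a positive integer (the upper critical mass) with $n'>K$. Put $\mathrm{SumInterDist}(A,B)=\sum_{u\in A,\,v\in B}\mathrm{dist}(u,v)$ and, for a worker $u$ and a set $A$ of workers, $\mathrm{dist}(u,A)=\sum_{v\in A}\mathrm{dist}(u,v)$. **Problem SpltBOpt (optimal balanced partitioning).** Let $x=\lceil n'/K\rceil$, $k_1=\dots=k_{x-1}=K$ and $k_x=n'-(x-1)K$. Among all partitions of $\mathcal{G}$ into $x$ disjoint subgroups $G_1,\dots,G_x$ with $|G_i|=k_i$, find one minimizing $\sum_{i<j}\mathrm{SumInterDist}(G_i,G_j)$. **Algorithm Min-Star-Partition.** With $x=\lceil n'/K\rceil$, $k_1=\dots=k_{x-1}=K$ and $k_x=n'-(x-1)K$, the algorithm goes through all choices of $x$ distinct workers $u_1,\dots,u_x\in\mathcal{G}$ (the centers, with $u_i$ the center of the subgroup of size $k_i$). For each choice it computes, exactly, via a transportation problem, a partition $G_1,\dots,G_x$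 of $\mathcal{G}$ with $u_i\in G_i$ and $|G_i|=k_i$ that minimizes the Min-Star objective $$\sum_{i=1}^{x}k_i\,\mathrm{dist}\Big(u_i,\bigcup_{j\ne i}G_j\Big)+\sum_{i<j}k_ik_j\,\mathrm{dist}(u_i,u_j),$$ whose second term is constant for fixed centers. It then evaluates $\sum_{i<j}\mathrm{SumInterDist}(G_i,G_j)$ on the resulting partition. Finally it returns the partition with the smallest value of $\sum_{i<j}\mathrm{SumInterDist}(G_i,G_j)$ over all choices of centers. *)

(* Defs.v *)
From mathcomp Require Import all_boot all_order all_algebra.

Set Implicit Arguments.
Unset Strict Implicit.
Unset Printing Implicit Defensive.

Import Order.TTheory GRing.Theory Num.Theory.
Local Open Scope ring_scope.

(* The group of workers is a finite type T, so n' is #|T|. Distances take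
   values in an arbitrary ordered field R, the real numbers included. *)

(* The ceiling of n / K, for 0 < K; see nb_partsE. *)
Definition nb_parts (n K : nat) : nat := (n + K.-1) %/ K.

(* Subgroups are indexed from 0, so the last one has index (nb_parts n K).-1. *)
Definition part_size (n K : nat) (i : 'I_(nb_parts n K)) : nat :=
  if i.+1 == nb_parts n K then (n - (nb_parts n K).-1 * K)%N else K.

Lemma nb_partsE (n K : nat) :
  (0 < K)%N -> Num.ceil (n%:R / K%:R : rat) = (nb_parts n K)%:Z.
Proof.
move=> K_gt0; apply: ceil_def; have K_gt0' : 0 < K%:R :> rat by rewrite ltr0n.
rewrite ler_pdivrMr // ltr_pdivlMr // -pmulrn rmorphB /= mulrBl -pmulrn mul1r.
rewrite ltrBlDr -natrM -natrD ltr_nat ler_nat /nb_parts.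
have := divn_eq (n + K.-1) K; have := ltn_pmod (n + K.-1) K_gt0.
move: (_ %/ _)%N (_ %% _)%N => q r; case: K K_gt0 {K_gt0'} => // K' _ /=.
rewrite ltnS => le_rK e; rewrite addnS ltnS e leq_addr /=.
by rewrite -(leq_add2r K') e leq_add2l.
Qed.

Section SpltBOpt.

Variables (R : realFieldType) (T : finType) (dist : T -> T -> R) (K : nat).

Definition is_distance : Prop :=
  [/\ forall u v, 0 <= dist u v,
      forall u, dist u u = 0 &
      forall u v, dist u v = dist v u].

Definition triangle_inequality : Prop :=
  forall u v w, dist u w <= dist u v + dist v w.

Definition dist_set (u : T) (A : {set T}) : R := \sum_(v in A) dist u v.

Definition sum_inter_dist (A B : {set T}) : R :=
  \sum_(u in A) \sum_(v in B) dist u v.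

Local Notation x := (nb_parts #|T| K).
Local Notation k := (@part_size #|T| K).

Definition splitting : Type := {ffun 'I_x -> {set T}}.

Definition feasible (G : splitting) : Prop :=
  [/\ forall i j, i != j -> [disjoint G i & G j],
      \bigcup_i G i = [set: T] &
      forall i, #|G i| = k i].

Definition inter_cost (G : splitting) : R :=
  \sum_(i < x) \sum_(j < x | (i < j)%N) sum_inter_dist (G i) (G j).

Definition is_optimal_value (opt : R) : Prop :=
  (exists2 G, feasible G & inter_cost G = opt) /\
  (forall G, feasible G -> opt <= inter_cost G).

Definition centers : Type := {ffun 'I_x -> T}.

Definition min_star_objective (u : centers) (G : splitting) : R :=
  \sum_(i < x) (k i)%:R * dist_set (u i) (\bigcup_(j < x | j != i) G j)
  + \sum_(i < x) \sum_(j < x | (i < j)%N)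
      (k i)%:R * (k j)%:R * dist (u i) (u j).

Definition feasible_at (u : centers) (G : splitting) : Prop :=
  feasible G /\ forall i, u i \in G i.

Definition min_star_optimal (u : centers) (G : splitting) : Prop :=
  feasible_at u G /\
  forall H, feasible_at u H -> min_star_objective u G <= min_star_objective u H.

(* G is a possible output of Min-Star-Partition. The algorithm leaves ties
   unresolved, both among the optima of a transportation problem and among the
   centers; hence a relation, where [sel u] is the partition computed for the
   centers u. *)
Definition min_star_partition_returns (G : splitting) : Prop :=
  exists2 sel : centers -> splitting,
    forall u : centers, injective u -> min_star_optimal u (sel u) &
    exists2 u : centers,
      injective u /\ sel u = G &
      forall w : centers, injective w -> inter_cost G <= inter_cost (sel w).

End SpltBOpt.

(* Main.v *)
(* Let O be an optimal partition and let each center u_i be drawn uniformly and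
   independently from O_i. The three groups of terms of the Min-Star objective
   of O then each have mean equal to the cost of O, so some choice of centers
   has Min-Star objective at most three times the optimum. Conversely, the
   triangle inequality along a, u_j, u_i, b for a in G_i and b in G_j bounds the
   cost of any partition G by its Min-Star objective. *)

Require Import Defs.
From mathcomp Require Import all_boot all_order all_algebra.
From mathcomp Require Import perm zify ring lra.

Set Implicit Arguments.
Unset Strict Implicit.
Unset Printing Implicit Defensive.

Import Order.TTheory GRing.Theory Num.Theory.
Local Open Scope ring_scope.

(** * Arithmetic of the number and sizes of the parts *)

Section PartSize.

Variables (n K : nat) (K_gt0 : (0 < K)%N) (n_gtK : (K < n)%N).

Lemma nb_parts_gt0 : (0 < nb_parts n K)%N.
Proof. by rewrite divn_gt0 // (leq_trans (ltnW n_gtK)) ?leq_addr. Qed.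

(** The strict bound makes the last part nonempty; the other one lets blocks of size [K] cover all
    workers. *)
Lemma nb_parts_bounds :
  ((nb_parts n K).-1 * K < n)%N /\ (n <= nb_parts n K * K)%N.
Proof.
have := nb_parts_gt0; have := divn_eq (n + K.-1) K.
have := ltn_pmod (n + K.-1) K_gt0.
rewrite -/(nb_parts n K); move: (_ %% _)%N => r.
by case: (nb_parts n K) => // q; rewrite mulSn /=; lia.
Qed.

Lemma part_size_gt0 (i : 'I_(nb_parts n K)) : (0 < part_size i)%N.
Proof.
rewrite /part_size; case: ifP => // _.
by rewrite subn_gt0; case: nb_parts_bounds.
Qed.

Lemma nb_parts_leq : (nb_parts n K <= n)%N.
Proof.
have [lt_n _] := nb_parts_bounds; have := nb_parts_gt0.
by case: (nb_parts n K) lt_n => //= q; nia.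
Qed.

Lemma card_ord_interval (a b : nat) :
  (a <= b <= n)%N -> #|[set m : 'I_n | (a <= m < b)%N]| = (b - a)%N.
Proof.
case/andP=> le_ab le_bn; rewrite cardsE -sum1_card.
rewrite -(big_mkord (fun m => a <= m < b)%N (fun=> 1%N)).
rewrite (@big_cat_nat _ _ _ b) //= (@big_cat_nat _ _ _ a) //=.
rewrite [X in (X + _ + _)%N]big_nat_cond big1 ?add0n; last first.
  by move=> m; case/andP=> *; lia.
rewrite [X in (_ + X)%N]big_nat_cond [X in (_ + X)%N]big1 ?addn0; last first.
  by move=> m; case/andP=> *; lia.
by rewrite -big_nat sum_nat_const_nat muln1.
Qed.

(** Cutting ['I_n] into consecutive blocks of length [K] realizes the prescribed sizes; only the
    last block may be cut short, by [n]. *)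
Lemma card_ord_divn (i : 'I_(nb_parts n K)) :
  #|[set m : 'I_n | (m %/ K)%N == i]| = part_size i.
Proof.
have [lt_n le_n] := nb_parts_bounds; have lt_i := ltn_ord i.
have divE (m : nat) : ((m %/ K)%N == i) = (i * K <= m < i.+1 * K)%N.
  by rewrite eqn_leq -ltnS ltn_divLR // leq_divRL // andbC.
rewrite /part_size; case: eqP => [last_i | not_last].
  have i_last : (nb_parts n K).-1 = i by move: last_i; lia.
  rewrite i_last in lt_n *; rewrite -card_ord_interval ?leqnn ?andbT 1?ltnW //.
  apply: eq_card => m; rewrite !inE divE ltn_ord last_i.
  by rewrite (leq_trans (ltn_ord m) le_n).
have le_iK : (i.+1 * K <= n)%N.
  by rewrite (leq_trans _ (ltnW lt_n)) // leq_mul2r; lia.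
rewrite -[RHS](addnK (i * K)%N) -mulSn -card_ord_interval.
  by apply: eq_card => m; rewrite !inE divE.
by rewrite le_iK leq_mul2r leqnSn orbT.
Qed.

End PartSize.

(** List the image of each injection, then its complement. Both lists enumerate [T] without
    repetition, and matching equal positions gives the permutation. *)
Lemma perm_extending_injections (I T : finType) (u v : I -> T) :
  injective u -> injective v -> exists p : {perm T}, forall i, p (v i) = u i.
Proof.
pose s (w : I -> T) := codom w ++ enum [predC codom w].
have s_uniq w : injective w -> uniq (s w).
  move=> w_inj; rewrite cat_uniq enum_uniq andbT (map_inj_uniq w_inj) enum_uniq.
  by apply/hasPn=> t; rewrite mem_enum.
have mem_s w t : t \in s w by rewrite mem_cat mem_enum inE orbN.
have size_s w : injective w -> size (s w) = #|T|.
  by move=> /s_uniq/card_uniqP <-; apply: eq_card => t; rewrite mem_s.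
move=> u_inj v_inj.
pose f t := nth t (s u) (index t (s v)).
have lt_s t : (index t (s v) < size (s u))%N.
  by rewrite size_s // -(size_s v) // index_mem.
have f_inj : injective f.
  move=> t t'; rewrite /f (set_nth_default t') // => /eqP.
  rewrite nth_uniq ?s_uniq // => /eqP/(congr1 (nth t (s v))).
  by rewrite !nth_index.
exists (perm f_inj) => i; rewrite permE /f /s index_cat codom_f index_map //.
rewrite nth_cat size_map index_mem mem_enum.
by rewrite (nth_map i) ?nth_index ?index_mem ?mem_enum.
Qed.

Lemma exists_minimizer (R : realFieldType) (S : finType) (P : pred S)
    (F : S -> R) (s0 : S) :
  P s0 -> exists2 s, P s & forall t, P t -> F s <= F t.
Proof. by move=> Ps0; case: (arg_minP F Ps0) => s Ps min_s; exists s. Qed.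

(** * Averaging over independent uniform representatives *)

Section RandomRepresentatives.

Variables (R : realFieldType) (I T : finType) (A : I -> {set T}).
Hypothesis A_neq0 : forall i, (0 < #|A i|)%N.

Local Notation w i t := ((t \in A i)%:R / #|A i|%:R : R).

Let sum_w i (F : T -> R) :
  \sum_t w i t * F t = (\sum_(t in A i) F t) / #|A i|%:R.
Proof.
rewrite mulr_suml [RHS]big_mkcond; apply: eq_bigr => t _.
by case: (t \in A i); rewrite /= ?mul0r // mul1r mulrC.
Qed.

Let sum_w1 i : \sum_t w i t = 1.
Proof.
rewrite -(eq_bigr _ (fun t _ => mulr1 (w i t))).
by rewrite sum_w sumr_const divff // pnatr_eq0 -lt0n.
Qed.

(* Under the weights [\prod_l w l (u l)] the coordinates [u l] are independent
   and [u l] is uniform on [A l]. *)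
Let sum_w_pair i j (h : T -> T -> R) : i != j ->
  \sum_(u : {ffun I -> T}) (\prod_l w l (u l)) * h (u i) (u j) =
  (\sum_(a in A i) \sum_(b in A j) h a b) / (#|A i|%:R * #|A j|%:R).
Proof.
move=> ij; have ji : j != i by rewrite eq_sym.
(* The indicator of [u i = a] and [u j = b] is written as a product over all coordinates, so that
   the sum over [u] factors by distributivity. *)
pose e (a b : T) (l : I) (t : T) : R := if l == i then (t == a)%:R else
                      if l == j then (t == b)%:R else 1.
have e_prod a b (u : {ffun I -> T}) :
    \prod_l e a b l (u l) = (u i == a)%:R * (u j == b)%:R.
  rewrite (bigD1 i) //= (bigD1 j) //= big1 ?mulr1.
    by rewrite /e !eqxx (negPf ji).
  by move=> l /andP[li lj]; rewrite /e (negPf li) (negPf lj).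
have joint a b : \sum_(u : {ffun I -> T})
    (\prod_l w l (u l)) * ((u i == a)%:R * (u j == b)%:R) = w i a * w j b.
  under eq_bigr do rewrite -e_prod -big_split /=.
  rewrite -(bigA_distr_bigA (fun l t => w l t * e a b l t)).
  rewrite (bigD1 i) //= (bigD1 j) //= [X in _ * (_ * X)]big1 ?mulr1; last first.
    move=> l /andP[li lj]; rewrite -[RHS](sum_w1 l); apply: eq_bigr => t _.
    by rewrite /e (negPf li) (negPf lj) mulr1.
  congr (_ * _); [rewrite (bigD1 a) | rewrite (bigD1 b)] => //=;
    rewrite /e ?eqxx ?(negPf ji) mulr1 big1 ?addr0 //.
    by move=> t /negPf->; rewrite mulr0.
  by move=> t /negPf->; rewrite mulr0.
transitivity (\sum_a \sum_b w i a * w j b * h a b).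
  under [RHS]eq_bigr => a _ do under eq_bigr => b _ do
    rewrite -joint mulr_suml.
  under [RHS]eq_bigr => a _ do rewrite exchange_big /=.
  rewrite [RHS]exchange_big /=; apply: eq_bigr => u _.
  rewrite [RHS](bigD1 (u i)) //= [X in _ = _ + X]big1 ?addr0; last first.
    move=> a; rewrite eq_sym => /negPf ua; rewrite big1 // => b _.
    by rewrite ua mul0r mulr0 mul0r.
  rewrite (bigD1 (u j)) //= [X in _ = _ + X]big1 ?addr0 ?eqxx ?mulr1 //.
  by move=> b; rewrite eq_sym => /negPf ub; rewrite ub !mulr0 mul0r.
under eq_bigr => a _ do (under eq_bigr => b _ do rewrite -mulrA;
  rewrite -mulr_sumr sum_w).
by rewrite sum_w -mulr_suml -mulrA -invfM [(#|A j|%:R * _)]mulrC.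
Qed.

(** The right-hand side is a mean, by linearity, and some outcome of positive weight does not exceed
    the mean; positive weight forces each [u i] into [A i]. *)
Lemma exists_representatives_le_average (P : rel I)
    (h : I -> I -> T -> T -> R) :
  (forall i j, P i j -> i != j) ->
  exists2 u : {ffun I -> T}, forall i, u i \in A i &
    \sum_i \sum_(j | P i j) h i j (u i) (u j) <=
    \sum_i \sum_(j | P i j)
      (\sum_(a in A i) \sum_(b in A j) h i j a b) / (#|A i|%:R * #|A j|%:R).
Proof.
move=> P_neq; pose W (u : {ffun I -> T}) := \prod_l w l (u l).
pose F (u : {ffun I -> T}) := \sum_i \sum_(j | P i j) h i j (u i) (u j).
set M := \sum_i \sum_(j | P i j)
  (\sum_(a in A i) \sum_(b in A j) h i j a b) / (#|A i|%:R * #|A j|%:R).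
have W_sum : \sum_u W u = 1.
  by rewrite -(bigA_distr_bigA (fun l t => w l t)) big1.
have F_mean : \sum_u W u * F u = M.
  under eq_bigr do rewrite mulr_sumr; rewrite exchange_big /=.
  apply: eq_bigr => i _.
  under eq_bigr do rewrite mulr_sumr; rewrite exchange_big /=.
  by apply: eq_bigr => j Pij; rewrite sum_w_pair ?P_neq.
have W_ge0 u : 0 <= W u by rewrite prodr_ge0 // => l _; rewrite divr_ge0.
have [/existsP[u /andP[/forallP Au leFM]] | no_u] :=
  boolP [exists u : {ffun I -> T}, [forall i, u i \in A i] && (F u <= M)];
  first by exists u.
have gtFM u : W u != 0 -> M < F u.
  move=> Wu; rewrite ltNge; apply: contra no_u => leFM.
  apply/existsP; exists u; rewrite leFM andbT; apply/forallP => i.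
  by apply: contraNT Wu => uNA; rewrite /W (bigD1 i) //= (negPf uNA) !mul0r.
(* Nonnegative terms with sum zero all vanish. As [F u] exceeds [M] wherever [W u] is nonzero, every
   weight is zero, against total weight 1. *)
have sum0 : \sum_u W u * (F u - M) = 0.
  under eq_bigr do rewrite mulrBr.
  by rewrite sumrB -mulr_suml W_sum F_mean mul1r subrr.
have ge0 u : 0 <= W u * (F u - M).
  have [->|Wu] := eqVneq (W u) 0; first by rewrite mul0r.
  by rewrite mulr_ge0 // subr_ge0 ltW ?gtFM.
have W0 u : W u = 0.
  have /eqP := sum0; rewrite psumr_eq0 // => /allP/(_ u (mem_index_enum u)) /=.
  rewrite mulf_eq0 => /orP[/eqP //|]; rewrite subr_eq0 => /eqP FM.
  by apply/eqP; apply: contraTT (lexx M) => /gtFM; rewrite FM ltxx.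
by move/eqP: W_sum; rewrite big1 // eq_sym oner_eq0.
Qed.

End RandomRepresentatives.

Section MinStar.

Variables (R : realFieldType) (T : finType) (dist : T -> T -> R) (K : nat).
Hypothesis dist_sym : forall u v, dist u v = dist v u.

Local Notation x := (nb_parts #|T| K).
Local Notation k := (@part_size #|T| K).

(** Boolean form, for taking minimizers over the finite type of splittings. *)
Definition feasibleb (G : splitting T K) : bool :=
  [&& [forall i, forall j, (i != j) ==> [disjoint G i & G j]],
      \bigcup_i G i == [set: T] & [forall i, #|G i| == k i]].

Lemma feasibleP (G : splitting T K) : reflect (feasible G) (feasibleb G).
Proof.
apply: (iffP and3P) => [[/forallP dG /eqP cG /forallP sG]|[dG cG sG]];
  split=> //.
- by move=> i j ij; have /forallP/(_ j)/implyP/(_ ij) := dG i.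
- by move=> i; apply/eqP.
- by apply/forallP=> i; apply/forallP=> j; apply/implyP; apply: dG.
- exact/eqP.
- by apply/forallP=> i; apply/eqP.
Qed.

Definition feasible_atb (u : centers T K) (G : splitting T K) : bool :=
  feasibleb G && [forall i, u i \in G i].

Lemma feasible_atP (u : centers T K) (G : splitting T K) :
  reflect (feasible_at u G) (feasible_atb u G).
Proof. by apply: (iffP andP) => -[/feasibleP fG /forallP uG]. Qed.

(** Makes representatives of a partition an admissible choice of centers for the algorithm. *)
Lemma feasible_centers_inj (G : splitting T K) (u : centers T K) :
  feasible G -> (forall i, u i \in G i) -> injective u.
Proof.
move=> [dG _ _] uG i j uij; apply/eqP; apply: contraT => /dG.
by move/disjointFr/(_ (uG i)); rewrite uij uG.
Qed.

(** * Existence of feasible partitions, of outputs and of an optimum *)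

Section Existence.

Hypotheses (K_gt0 : (0 < K)%N) (K_lt : (K < #|T|)%N).

Lemma feasible_exists : exists G : splitting T K, feasible G.
Proof.
exists [ffun i : 'I_x => [set t | (enum_rank t %/ K)%N == i]]; split.
- move=> i j ij; rewrite !ffunE; apply/pred0P => t /=; rewrite !inE.
  apply: contraNF ij => /andP[/eqP ti /eqP tj].
  by apply/eqP/val_inj; rewrite /= -ti -tj.
- apply/setP=> t; rewrite inE; apply/bigcupP.
  have lt_x : (enum_rank t %/ K < x)%N.
    rewrite ltn_divLR // (leq_trans (ltn_ord _)) //.
    by have [] := nb_parts_bounds K_gt0 K_lt.
  by exists (Ordinal lt_x); rewrite ?ffunE ?inE.
move=> i; rewrite ffunE -card_ord_divn // -(card_imset _ (@enum_rank_inj T)).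
apply: eq_card => m; rewrite inE; apply/imsetP/idP => [[t] | mi].
  by rewrite inE => ti ->.
by exists (enum_val m); rewrite ?inE enum_valK.
Qed.

(** Pick representatives [v] of any feasible partition; a permutation carrying [v] to [u] transports
    the partition and preserves sizes. *)
Lemma feasible_at_exists (u : centers T K) :
  injective u -> exists G : splitting T K, feasible_at u G.
Proof.
move=> u_inj; have [G fG] := feasible_exists; have [dG cG sG] := fG.
have /fin_all_exists[v vG] (i : 'I_x) : exists t, t \in G i.
  by apply/card_gt0P; rewrite sG part_size_gt0.
have v_inj : injective v.
  have vG' i : [ffun i => v i] i \in G i by rewrite ffunE.
  by move=> i j vij; apply: (feasible_centers_inj fG vG'); rewrite !ffunE.
have [p pv] := perm_extending_injections u_inj v_inj.
exists [ffun i => p @: G i]; split; last first.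
  by move=> i; rewrite ffunE -pv imset_f.
split=> [i j /dG ij||i].
- by rewrite !ffunE imset_disjoint //; exact: perm_inj.
- apply/setP=> t; rewrite inE; apply/bigcupP.
  have : (p^-1)%g t \in \bigcup_i G i by rewrite cG inE.
  case/bigcupP=> i _ ti; exists i; rewrite // ffunE.
  by rewrite -(permKV p t) imset_f.
by rewrite ffunE card_imset //; exact: perm_inj.
Qed.

Lemma min_star_optimal_exists (u : centers T K) :
  injective u -> exists G, min_star_optimal dist u G.
Proof.
move=> /feasible_at_exists[G /feasible_atP fG].
have [H /feasible_atP fH minH] :=
  exists_minimizer (P := feasible_atb u) (min_star_objective dist u) fG.
by exists H; split=> // H' /feasible_atP/minH.
Qed.

Lemma min_star_partition_exists :
  exists G : splitting T K, min_star_partition_returns dist G.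
Proof.
have /fin_all_exists[sel selP] (u : {ffun 'I_x -> T}) :
    exists G, injective u -> min_star_optimal dist u G.
  have [/injectiveP u_inj|u_ninj] := boolP (injectiveb u).
    by have [G optG] := min_star_optimal_exists u_inj; exists G.
  (* Dummy value: nothing is required of [sel] at centers that are not distinct. *)
  by exists [ffun=> set0] => /injectiveP; rewrite (negPf u_ninj).
have u0_inj : injectiveb [ffun i : 'I_x =>
    enum_val (widen_ord (nb_parts_leq K_gt0 K_lt) i)].
  apply/injectiveP=> i j; rewrite !ffunE => /enum_val_inj/(congr1 val) /= ij.
  exact: val_inj.
have [u /injectiveP u_inj minu] :=
  exists_minimizer (P := fun u : {ffun 'I_x -> T} => injectiveb u)
    (fun u : {ffun 'I_x -> T} => inter_cost dist (sel u)) u0_inj.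
exists (sel u); exists sel => //; exists u => //.
by move=> w /injectiveP/minu.
Qed.

Lemma optimal_exists : exists2 G : splitting T K,
  feasible G & is_optimal_value dist K (inter_cost dist G).
Proof.
have [G0 /feasibleP fG0] := feasible_exists.
have [G /feasibleP fG minG] :=
  exists_minimizer (P := feasibleb) (@inter_cost R T dist K) fG0.
by exists G => //; split; [exists G | move=> H /feasibleP/minG].
Qed.

End Existence.

(** * Comparison of the Min-Star objective with the cost *)

Lemma sum_neq_pairs (n : nat) (F : 'I_n -> 'I_n -> R) :
  \sum_i \sum_(j | j != i) F i j =
  \sum_(i < n) \sum_(j < n | (i < j)%N) (F i j + F j i).
Proof.
under [RHS]eq_bigr do rewrite big_split /=.
rewrite big_split /= [X in _ = _ + X](exchange_big_dep predT) //= -big_split /=.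
apply: eq_bigr => i _; rewrite (bigID (fun j : 'I_n => (i < j)%N)) /=.
congr (_ + _); apply: eq_bigl => j; rewrite -(inj_eq val_inj) /=.
  by case: ltngtP.
by case: ltngtP.
Qed.

(** Disjointness splits the distance to a union into distances to single parts. Both comparisons
    with the cost can then be made pair by pair. *)
Lemma min_star_objectiveE (u : centers T K) (G : splitting T K) :
  feasible G ->
  min_star_objective dist u G =
  \sum_(i < x) \sum_(j < x | (i < j)%N)
    ((k i)%:R * dist_set dist (u i) (G j) + (k j)%:R * dist_set dist (u j) (G i)
     + (k i)%:R * (k j)%:R * dist (u i) (u j)).
Proof.
move=> [dG _ _]; under [RHS]eq_bigr do rewrite big_split /=.
rewrite [RHS]big_split /=.
rewrite -(sum_neq_pairs (fun i j => (k i)%:R * dist_set dist (u i) (G j))).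
congr (_ + _); apply: eq_bigr => i _; rewrite -mulr_sumr; congr (_ * _).
(* The excluded index [i] is given the empty set, which keeps the family disjoint over all
   indices. *)
rewrite /dist_set (big_mkcond (fun j => j != i)) partition_disjoint_bigcup /=.
  rewrite [RHS]big_mkcond; apply: eq_bigr => j _.
  by case: ifP; rewrite ?big_set0.
move=> a b /dG ab; case: ifP => _; last by rewrite disjoints_subset sub0set.
by case: ifP => // _; rewrite disjoint_sym disjoints_subset sub0set.
Qed.

(* Each d(a, b) is bounded along the path a, u j, u i, b, which swaps the
   centers: this is why only distances between a center and the other parts
   occur in the Min-Star objective. *)
Lemma inter_cost_le_min_star (u : centers T K) (G : splitting T K) :
  triangle_inequality dist -> feasible G ->
  inter_cost dist G <= min_star_objective dist u G.
Proof.
move=> tri fG; rewrite min_star_objectiveE //; have [_ _ sG] := fG.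
apply: ler_sum => i _; apply: ler_sum => j _.
apply: (@le_trans _ _ (\sum_(a in G i) \sum_(b in G j)
   (dist (u i) b + dist (u j) a + dist (u i) (u j)))).
  apply: ler_sum => a _; apply: ler_sum => b _.
  have := tri a (u j) b; have := tri (u j) (u i) b.
  by move: (dist_sym a (u j)) (dist_sym (u j) (u i)) => -> ->; lra.
under eq_bigr do rewrite !big_split /= !sumr_const.
rewrite !big_split /= !sumr_const sumrMnl !sG.
by rewrite /dist_set -mulrA !mulr_natl lexx.
Qed.

(* For u i uniform in G i, the three terms of each pair of parts all have mean
   sum_inter_dist (G i) (G j). *)
Lemma exists_centers_min_star_le (G : splitting T K) :
  (forall i, (0 < k i)%N) -> feasible G ->
  exists2 u : centers T K, forall i, u i \in G i &
    min_star_objective dist u G <= 3 * inter_cost dist G.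
Proof.
move=> k_gt0 fG; have [_ _ sG] := fG.
have [||u uG le_u] := @exists_representatives_le_average R _ _ G _
  (fun i j : 'I_x => (i < j)%N)
  (fun i j a b => (k i)%:R * dist_set dist a (G j)
     + (k j)%:R * dist_set dist b (G i) + (k i)%:R * (k j)%:R * dist a b).
- by move=> i; rewrite sG.
- by move=> i j; rewrite neq_ltn => ->.
exists u => //; rewrite min_star_objectiveE // (le_trans le_u) //.
rewrite /inter_cost mulr_sumr ler_sum // => i _.
rewrite mulr_sumr ler_sum // => j _.
rewrite ler_pdivrMr ?mulr_gt0 ?ltr0n ?sG //.
(* Each of the three terms sums to [k i * k j] times the cost of the pair: the first two ignore one
   of [a], [b], whose summation supplies the missing factor. *)
under eq_bigr do rewrite !big_split /= sumr_const -!mulr_sumr.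
rewrite !big_split /= !sumr_const sumrMnl -!mulr_sumr !sG.
have -> :
    \sum_(b in G j) dist_set dist b (G i) = sum_inter_dist dist (G i) (G j).
  by rewrite /sum_inter_dist exchange_big; do 2!apply: eq_bigr => ? _.
rewrite -!/(sum_inter_dist dist (G i) (G j)).
rewrite -[_ * _ *+ k j]mulr_natl -[_ * _ *+ k i]mulr_natl.
by rewrite le_eqVlt; apply/orP; left; apply/eqP; ring.
Qed.

End MinStar.

Theorem theorem6 (R : realFieldType) (T : finType) (dist : T -> T -> R)
    (K : nat) (hdist : is_distance dist) (htri : triangle_inequality dist)
    (hK : (0 < K)%N) (hn : (K < #|T|)%N) :
  (exists G : splitting T K, min_star_partition_returns dist G) /\
  (forall G : splitting T K, min_star_partition_returns dist G ->
     feasible G /\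
     exists2 opt : R, is_optimal_value dist K opt & inter_cost dist G <= 3 * opt).
Proof.
have [_ _ dist_sym] := hdist; split; first exact: min_star_partition_exists.
move=> G [sel selP [u [u_inj <-] min_u]]; split.
  by case: (selP u u_inj) => -[].
have [O fO optO] := optimal_exists dist hK hn.
exists (inter_cost dist O) => //.
have [v vO le_v] :=
  exists_centers_min_star_le dist_sym (part_size_gt0 hK hn) fO.
have v_inj := feasible_centers_inj fO vO.
have [[f_sel _] min_sel] := selP v v_inj.
(* The output costs at most [sel v], whose cost is at most its Min-Star objective at [v], hence at
   most that of [O] at [v], which is within 3 times the optimum. *)
apply: le_trans (min_u v v_inj) _; apply: le_trans le_v.
apply: le_trans (min_sel O (conj fO vO)).
exact: inter_cost_le_min_star.
Qed.
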